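(* Let $R\subseteq\mathbb N\times\mathbb N$ be a binary relation and $f,g:(\mathbb N\to\mathbb N)\to\mathbb N$. There is a map which, given Diophantine witnesses for $f$, $g$ and for the relation $\nu\mapsto R(\nu(1),\nu(0))$, produces a Diophantine witness for the relation $\nu\mapsto R^*(f\nu,g\nu)$, where $R^*$ is the reflexive-transitive closure of $R$.
   Context: Diophantine logic formulas are $A,B::= x_i\doteq n\mid x_i\doteq x_j\mid x_i\doteq x_j\dot+x_k\mid x_i\doteq x_j\dot\times x_k\mid A\dot\wedge B\mid A\dot\vee B\mid\dot\exists A$, with De Bruijn indices. For valuations $\nu:\mathbb N\to\mathbb N$ the semantics is as follows. - Atoms have their obvious meaning, e.g. $[\![x_i\doteq x_j\dot+x_k]\!]\nu\iff\nu(i)=\nu(j)+\nu(k)$. - $\dot\wedge$ and $\dot\vee$ are interpreted as $\wedge$ and $\vee$. - $[\![\dot\exists A]\!]\nu\iff\exists n,\ [\![A]\!](n\cdot\nu)$, with $(n\cdot\nu)(0)=n$ and $(n\cdot\nu)(i+1)=\nu(i)$. A Diophantine witness for a relation $S$ on valuations is a formula $A$ with $[\![A]\!]\nu\leftrightarrow S\,\nu$ for all $\nu$. A Diophantine witness for $f:(\mathbb N\to\mathbb N)\to\mathbb N$ is one for the relation $\nu\mapsto\nu(0)=f(\uparrow\nu)$, where $(\uparrow\nu)(i)=\nu(i+1)$. *)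

(* Defs.v *)
From Stdlib Require Import Relation_Operators.

(* Variables are De Bruijn indices: [dio_eq_cst i n] is x_i = n, and
   [dio_eq_add i j k], [dio_eq_mul i j k] have x_i as their left-hand side. *)
Inductive dio_formula : Set :=
| dio_eq_cst (i n : nat)
| dio_eq_var (i j : nat)
| dio_eq_add (i j k : nat)
| dio_eq_mul (i j k : nat)
| dio_and (A B : dio_formula)
| dio_or (A B : dio_formula)
| dio_exists (A : dio_formula).

Definition valuation := nat -> nat.

Definition val_cons (n : nat) (v : valuation) : valuation :=
  fun i => match i with 0 => n | S j => v j end.

Definition val_up (v : valuation) : valuation := fun i => v (S i).

Fixpoint dio_sem (A : dio_formula) (v : valuation) : Prop :=
  match A with
  | dio_eq_cst i n => v i = n
  | dio_eq_var i j => v i = v j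
  | dio_eq_add i j k => v i = v j + v k
  | dio_eq_mul i j k => v i = v j * v k
  | dio_and A B => dio_sem A v /\ dio_sem B v
  | dio_or A B => dio_sem A v \/ dio_sem B v
  | dio_exists A => exists n, dio_sem A (val_cons n v)
  end.

(* Witnesses are informative (in [Set], not [Prop]): a function between these
   types is a map that transforms formulas. *)
Definition dio_rel (S : valuation -> Prop) : Set :=
  {A : dio_formula | forall v, dio_sem A v <-> S v}.

Definition dio_fun (f : valuation -> nat) : Set :=
  dio_rel (fun v => v 0 = f (val_up v)).

(* Main.v *)
(* A path of R is coded by the base-b digits of one number, so that R^* becomes a
   bounded universal quantification over a Diophantine relation.  Such a quantifier
   is removed by Chinese remaindering: the variables of the matrix become numbers
   modulo the coprime divisors t/i - 1 of the binomial (t - 1 choose n), where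
   t = i, and a Diophantine equation holds for every i iff it holds modulo the
   binomial and the remainders are small.  The remainder of x modulo a large prime
   p is at most u iff p divides (x choose u + 1).  Disjunctions are handled by
   multiplying both sides of the equations of the two branches by numbers e1, e2
   with e1 + e2 = 1, so that modulo each prime one branch is not annihilated.
   Binomials and factorials reduce to exponentiation, and exponentiation to the
   solutions of x^2 - b x y + y^2 = 1, which are the consecutive terms of a Lucas
   sequence; the latter is Diophantine by Matiyasevich's argument. *)
Require Import Defs.
From Stdlib Require Import Relation_Operators Operators_Properties ZArith Lia.
From mathcomp Require Import all_boot zify_ssreflect.

Set Implicit Arguments.
Unset Strict Implicit.
Unset Printing Implicit Defensive.

(** * Closure properties *)

Lemma dio_sem_ext A v w : v =1 w -> dio_sem A v <-> dio_sem A w.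
Proof.
elim: A v w => [i n|i j|i j k|i j k|A IHA B IHB|A IHA B IHB|A IHA] v w vw /=;
  rewrite ?vw //.
- by rewrite (IHA _ _ vw) (IHB _ _ vw).
- by rewrite (IHA _ _ vw) (IHB _ _ vw).
- have E n : val_cons n v =1 val_cons n w by case.
  by split=> -[n]; exists n; apply/(IHA _ _ (E n)).
Qed.

Fixpoint dio_rename (r : nat -> nat) (A : dio_formula) : dio_formula :=
  match A with
  | dio_eq_cst i n => dio_eq_cst (r i) n
  | dio_eq_var i j => dio_eq_var (r i) (r j)
  | dio_eq_add i j k => dio_eq_add (r i) (r j) (r k)
  | dio_eq_mul i j k => dio_eq_mul (r i) (r j) (r k)
  | dio_and A B => dio_and (dio_rename r A) (dio_rename r B)
  | dio_or A B => dio_or (dio_rename r A) (dio_rename r B)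
  | dio_exists A =>
      dio_exists (dio_rename (fun i => if i is j.+1 then (r j).+1 else 0) A)
  end.

Lemma dio_sem_rename r A v :
  dio_sem (dio_rename r A) v <-> dio_sem A (fun i => v (r i)).
Proof.
elim: A r v => [i n|i j|i j k|i j k|A IHA B IHB|A IHA B IHB|A IHA] r v //=.
- by rewrite IHA IHB.
- by rewrite IHA IHB.
- have E n : (fun i => val_cons n v (if i is j.+1 then (r j).+1 else 0))
               =1 val_cons n (fun i => v (r i)) by case.
  split=> -[n] H; exists n; move: H.
    by move/IHA/(dio_sem_ext _ (E n)).
  by move=> H; apply/IHA/(dio_sem_ext _ (E n)).
Qed.

Section Closure.
Implicit Types (S T : valuation -> Prop) (f g h : valuation -> nat).

Lemma dio_ext S T : (forall v, S v <-> T v) -> dio_rel S -> dio_rel T.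
Proof. by move=> ST [A AP]; exists A => v; rewrite AP. Qed.

Lemma dio_ren (r : nat -> nat) S :
  dio_rel S -> dio_rel (fun v => S (fun i => v (r i))).
Proof.
by move=> [A AP]; exists (dio_rename r A) => v; rewrite dio_sem_rename AP.
Qed.

Lemma dio_conj S T : dio_rel S -> dio_rel T -> dio_rel (fun v => S v /\ T v).
Proof.
by move=> [A AP] [B BP]; exists (dio_and A B) => v /=; rewrite AP BP.
Qed.

Lemma dio_disj S T : dio_rel S -> dio_rel T -> dio_rel (fun v => S v \/ T v).
Proof.
by move=> [A AP] [B BP]; exists (dio_or A B) => v /=; rewrite AP BP.
Qed.

Lemma dio_ex (S : nat -> valuation -> Prop) :
  dio_rel (fun v => S (v 0) (val_up v)) -> dio_rel (fun v => exists n, S n v).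
Proof.
move=> [A AP]; exists (dio_exists A) => v /=.
by split=> -[n Sn]; exists n; apply/(AP (val_cons n v)).
Qed.

Lemma dio_funext f g : f =1 g -> dio_fun f -> dio_fun g.
Proof. by move=> fg; apply: dio_ext => v; rewrite fg. Qed.

Lemma dio_eq f g : dio_fun f -> dio_fun g -> dio_rel (fun v => f v = g v).
Proof.
move=> Df Dg.
apply: (dio_ext (S := fun v => exists n, n = f v /\ n = g v)) => [v|].
  by split=> [[n [<- <-]]|fg] //; exists (f v).
exact: dio_ex (dio_conj Df Dg).
Qed.

Lemma dio_funup f : dio_fun f -> dio_fun (fun v => f (val_up v)).
Proof. exact: (@dio_ren (fun i => if i is j.+1 then j.+2 else 0)). Qed.

Lemma dio_var i : dio_fun (fun v => v i).
Proof. by exists (dio_eq_var 0 i.+1). Qed.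

Lemma dio_cst n : dio_fun (fun=> n).
Proof. by exists (dio_eq_cst 0 n). Qed.

Lemma dio_add f g : dio_fun f -> dio_fun g -> dio_fun (fun v => f v + g v).
Proof.
move=> Df Dg.
apply: (dio_ext (S := fun v => exists m, m = g (val_up v) /\
   exists n, n = f (val_up v) /\ v 0 = n + m)) => [v|].
  split=> [[m [-> [n [-> ->]]]]|->] //.
  by exists (g (val_up v)); split=> //; exists (f (val_up v)).
apply: dio_ex; apply: dio_conj; first exact: dio_funup Dg.
apply: dio_ex; apply: dio_conj; first exact: dio_funup (dio_funup Df).
by exists (dio_eq_add 2 0 1).
Qed.

Lemma dio_mul f g : dio_fun f -> dio_fun g -> dio_fun (fun v => f v * g v).
Proof.
move=> Df Dg.
apply: (dio_ext (S := fun v => exists m, m = g (val_up v) /\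
   exists n, n = f (val_up v) /\ v 0 = n * m)) => [v|].
  split=> [[m [-> [n [-> ->]]]]|->] //.
  by exists (g (val_up v)); split=> //; exists (f (val_up v)).
apply: dio_ex; apply: dio_conj; first exact: dio_funup Dg.
apply: dio_ex; apply: dio_conj; first exact: dio_funup (dio_funup Df).
by exists (dio_eq_mul 2 0 1).
Qed.

(** Formulas have no compound terms, so the substitution happens at the atoms, where the closure
    lemmas quantify over the values of the functions. Under a quantifier the family is shifted and
    index 0 kept. *)
Lemma dio_subst S (F : nat -> valuation -> nat) :
  (forall i, dio_fun (F i)) -> dio_rel S ->
  dio_rel (fun v => S (fun i => F i v)).
Proof.
move=> DF [A AP]; apply: (dio_ext (fun v => AP (fun i => F i v))) => {S AP}.
elim: A F DF => [i n|i j|i j k|i j k|A IHA B IHB|A IHA B IHB|A IHA] F DF /=.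
- exact: dio_eq (DF i) (dio_cst n).
- exact: dio_eq.
- exact: dio_eq (DF i) (dio_add (DF j) (DF k)).
- exact: dio_eq (DF i) (dio_mul (DF j) (DF k)).
- exact: dio_conj (IHA _ DF) (IHB _ DF).
- exact: dio_disj (IHA _ DF) (IHB _ DF).
- apply: dio_ex.
  pose F' i v := if i is j.+1 then F j (val_up v) else v 0.
  apply: (dio_ext (S := fun v => dio_sem A (fun i => F' i v))) => [v|].
    by apply: dio_sem_ext; case.
  by apply: IHA; case=> [|i]; [apply: dio_var | apply: dio_funup].
Qed.

Lemma dio_subst2 (S : nat -> nat -> Prop) f g :
  dio_rel (fun v => S (v 0) (v 1)) -> dio_fun f -> dio_fun g ->
  dio_rel (fun v => S (f v) (g v)).
Proof.
move=> DS Df Dg.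
by apply: (dio_subst (F := fun i => if i is 0 then f else g) _ DS); case.
Qed.

Lemma dio_subst3 (S : nat -> nat -> nat -> Prop) f g h :
  dio_rel (fun v => S (v 0) (v 1) (v 2)) ->
  dio_fun f -> dio_fun g -> dio_fun h -> dio_rel (fun v => S (f v) (g v) (h v)).
Proof.
move=> DS Df Dg Dh.
apply: (dio_subst (F := fun i => match i with 0 => f | 1 => g | _ => h end) _ DS).
by case=> [|[|?]].
Qed.

Lemma dio_fun2 (F : nat -> nat -> nat) f g :
  dio_rel (fun v => v 0 = F (v 1) (v 2)) -> dio_fun f -> dio_fun g ->
  dio_fun (fun v => F (f v) (g v)).
Proof.
move=> DF Df Dg.
exact: (dio_subst3 (S := fun x y z => x = F y z) DF (dio_var 0)
          (dio_funup Df) (dio_funup Dg)).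
Qed.

Lemma dio_succ f : dio_fun f -> dio_fun (fun v => (f v).+1).
Proof. by move/dio_add=> /(_ _ (dio_cst 1)); apply: dio_funext => v; rewrite addn1. Qed.

Lemma dio_le f g : dio_fun f -> dio_fun g -> dio_rel (fun v => f v <= g v).
Proof.
apply: (dio_subst2 (S := fun x y => is_true (x <= y))).
apply: (dio_ext (S := fun v => exists n, v 1 = v 0 + n)) => [v|].
  by split=> [[n ->]|vv]; [rewrite leq_addr | exists (v 1 - v 0); rewrite subnKC].
apply: dio_ex; exact: (dio_eq (dio_var _) (dio_add (dio_var _) (dio_var _))).
Qed.

Lemma dio_dvd f g : dio_fun f -> dio_fun g -> dio_rel (fun v => f v %| g v).
Proof.
apply: (dio_subst2 (S := fun x y => is_true (x %| y))).
apply: (dio_ext (S := fun v => exists n, v 1 = n * v 0)) => [v|].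
  by split=> [[n ->]|/dvdnP//]; rewrite dvdn_mull.
apply: dio_ex; exact: (dio_eq (dio_var _) (dio_mul (dio_var _) (dio_var _))).
Qed.

(** Multiples are added on both sides because either number may be the larger one. *)
Lemma eqmod_ex d x y : x = y %[mod d] <-> exists k l, x + k * d = y + l * d.
Proof.
split=> [xy|[k [l /(congr1 (modn^~ d))]]]; last first.
  by rewrite [x + _]addnC [y + _]addnC !modnMDl.
exists (y %/ d), (x %/ d); rewrite {1}(divn_eq x d) {2}(divn_eq y d) xy; lia.
Qed.

Lemma dio_eqmod f g h :
  dio_fun f -> dio_fun g -> dio_fun h -> dio_rel (fun v => f v = g v %[mod h v]).
Proof.
apply: (dio_subst3 (S := fun x y d => x = y %[mod d])).
apply: (dio_ext (fun v => iff_sym (eqmod_ex (v 2) (v 0) (v 1)))).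
apply: dio_ex; apply: dio_ex; apply: dio_eq;
  exact: dio_add (dio_var _) (dio_mul (dio_var _) (dio_var _)).
Qed.

End Closure.

(** A hook of [dio], redefined below as further functions are shown Diophantine. *)
Ltac dio_head := fail.
Ltac dio :=
  cbv beta delta [val_up];
  lazymatch goal with
  | |- dio_rel (fun v => _ /\ _) => apply: dio_conj; dio
  | |- dio_rel (fun v => _ \/ _) => apply: dio_disj; dio
  | |- dio_rel (fun v => exists n, _) => apply: dio_ex; dio
  | |- dio_rel (fun v => is_true (leq _ _)) => apply: dio_le; dio
  | |- dio_rel (fun v => is_true (dvdn _ _)) => apply: dio_dvd; dio
  | |- dio_rel (fun v => modn _ _ = modn _ _) => apply: dio_eqmod; dio
  | |- dio_rel (fun v => @eq nat _ _) => apply: dio_eq; dio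
  | |- dio_fun (fun v => addn _ _) => apply: dio_add; dio
  | |- dio_fun (fun v => muln _ _) => apply: dio_mul; dio
  | |- dio_fun (fun v => v _) => apply: dio_var
  | |- dio_fun (fun=> ?n) => apply: dio_cst
  | |- dio_fun (fun v => S _) => apply: dio_succ; dio
  | _ => first [assumption | dio_head; dio]
  end.

(** * Lucas sequences and the Pell equation x^2 - b x y + y^2 = 1 *)

Section Lucas.
Local Open Scope Z_scope.

(** The sequence U_n(P, Q) with P = b and Q = 1. *)
Fixpoint lucas (b : Z) (n : nat) : Z :=
  match n with
  | O => 0
  | S m => match m with O => 1 | S k => b * lucas b m - lucas b k end
  end.

Lemma lucasSS b n : lucas b n.+2 = b * lucas b n.+1 - lucas b n.
Proof. by []. Qed.

Lemma lucas0 b : lucas b 0 = 0.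
Proof. by []. Qed.

Lemma lucas1 b : lucas b 1 = 1.
Proof. by []. Qed.

Lemma lucas_incr b n : 2 <= b -> 0 <= lucas b n < lucas b n.+1.
Proof. by move=> b2; elim: n => [|n IHn] //; rewrite lucasSS; nia. Qed.

Lemma lucas_mono b m n : 2 <= b -> (m <= n)%N -> lucas b m <= lucas b n.
Proof.
move=> b2; elim: n => [|n IHn]; first by case: m.
rewrite leq_eqVlt => /orP[/eqP->|/IHn]; first lia.
by have := lucas_incr n b2; lia.
Qed.

Lemma lucas_ge b n : 2 <= b -> Z.of_nat n <= lucas b n.
Proof.
move=> b2; elim: n => [|n IHn] //.
by have := lucas_incr n b2; lia.
Qed.

Lemma lucas_geX b n : 1 <= b -> b ^ Z.of_nat n <= lucas (b + 1) n.+1.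
Proof.
move=> b1; elim: n => [|n IHn] //.
rewrite lucasSS Nat2Z.inj_succ Z.pow_succ_r; last lia.
have := @lucas_incr (b + 1) n ltac:(lia); nia.
Qed.

(** The quadratic form is invariant under (x, y) -> (b x - y, x), one step of the recurrence. *)
Lemma lucas_pell b n :
  lucas b n.+1 ^ 2 - b * lucas b n.+1 * lucas b n + lucas b n ^ 2 = 1.
Proof. by elim: n => [|n IHn]; [rewrite ?lucas0 ?lucas1; ring | rewrite lucasSS; lia]. Qed.

(** Descent: (x, y) goes back to (y, b y - x) until y = 0. *)
Lemma pell_lucas b x y : 2 <= b -> 0 <= y < x ->
  x ^ 2 - b * x * y + y ^ 2 = 1 -> exists n, x = lucas b n.+1 /\ y = lucas b n.
Proof.
move=> b2 y0; have [k ky] : exists k : nat, y < Z.of_nat k by exists (Z.to_nat (y + 1)); lia.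
elim: k x y y0 ky => [|k IHk] x y xy ky E; first lia.
have [y0|y0] : y = 0 \/ 0 < y by lia.
  by exists 0%N; subst; split=> //=; nia.
(* This factorisation gives 0 <= b y - x < y. *)
have F : x * (b * y - x) = y ^ 2 - 1 by lia.
have [|||n [En1 En]] := IHk y (b * y - x) _ _ _; try nia.
by exists n.+1; rewrite lucasSS -En1 -En; split=> //; lia.
Qed.

Lemma pell_is_lucas b x y : 2 <= b -> 0 <= x -> 0 <= y ->
  x ^ 2 - b * x * y + y ^ 2 = 1 -> exists n, x = lucas b n.
Proof.
move=> b2 x0 y0 E.
have [xy|[xy|xy]] : y < x \/ x < y \/ x = y by lia.
- by have [|n [-> _]] := pell_lucas b2 _ E; [lia | exists n.+1].
- have [||n [_ ->]] := @pell_lucas b y x b2 _ _; [lia| lia | by exists n].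
- by subst; nia.
Qed.

(** An entry of the product of two powers of the companion matrix of X^2 - b X + 1. *)
Lemma lucasD b m n :
  lucas b (m + n).+1 = lucas b m.+1 * lucas b n.+1 - lucas b m * lucas b n.
Proof.
suff [] : lucas b (m + n).+1 = lucas b m.+1 * lucas b n.+1 - lucas b m * lucas b n
  /\ lucas b (m + n).+2 = lucas b m.+1 * lucas b n.+2 - lucas b m * lucas b n.+1 by [].
elim: n => [|n [IH1 IH2]]; first by rewrite addn0 !lucasSS /=; split; ring.
rewrite addnS; split=> //.
by rewrite lucasSS IH2 IH1 !lucasSS; ring.
Qed.

Definition eqZ (d x y : Z) := (d | x - y).

Lemma eqZ_trans d y x z : eqZ d x y -> eqZ d y z -> eqZ d x z.
Proof. by move=> [k xy] [l yz]; exists (k + l); lia. Qed.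

Lemma eqZ_sym d x y : eqZ d x y -> eqZ d y x.
Proof. by move=> [k xy]; exists (- k); lia. Qed.

Lemma lucas_eqZ d b c n : eqZ d b c -> eqZ d (lucas b n) (lucas c n).
Proof.
move=> [k bc].
suff [] : eqZ d (lucas b n) (lucas c n) /\ eqZ d (lucas b n.+1) (lucas c n.+1) by [].
elim: n => [|n [[i IH1] [j IH2]]]; first by split; exists 0.
split; first by exists j.
exists (k * lucas b n.+1 + c * j - i).
rewrite !lucasSS.
have -> : b * lucas b n.+1 - lucas b n - (c * lucas c n.+1 - lucas c n) =
  (b - c) * lucas b n.+1 + c * (lucas b n.+1 - lucas c n.+1) - (lucas b n - lucas c n) by ring.
by rewrite bc IH1 IH2; ring.
Qed.

Lemma lucas2 n : lucas 2 n = Z.of_nat n.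
Proof.
suff [] : lucas 2 n = Z.of_nat n /\ lucas 2 n.+1 = Z.of_nat n.+1 by [].
by elim: n => [|n [IH1 IH2]] //; split=> //; rewrite lucasSS IH1 IH2; lia.
Qed.

(** * Divisibility between terms and between their indices *)

Lemma lucas_coprime b n d : (d | lucas b n) -> (d | lucas b n.+1) -> (d | 1).
Proof.
move=> [x xE] [y yE]; have := lucas_pell b n; rewrite xE yE => <-.
by exists (y ^ 2 * d - b * y * d * x + x ^ 2 * d); ring.
Qed.

Lemma lucas_sqr_mod b n : eqZ (lucas b n) (lucas b n.+1 ^ 2) 1.
Proof.
exists (b * lucas b n.+1 - lucas b n); have := lucas_pell b n; lia.
Qed.

(* With [P] the companion matrix, [P ^ k = lucas k * P - lucas (k - 1)]; the
   binomial expansion of [(P ^ k) ^ l] modulo [lucas k ^ 2] keeps two terms. *)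
Lemma lucas_mul b k l : exists e e',
  [/\ eqZ (lucas b k.+1) (e * e') 1,
      eqZ (lucas b k.+1 ^ 2) (lucas b (k.+1 * l)) (Z.of_nat l * e * lucas b k.+1) &
      eqZ (lucas b k.+1) (lucas b (k.+1 * l).+1) (e * lucas b k.+2)].
Proof.
have [y yE] := lucas_sqr_mod b k.+1.
elim: l => [|l [e [e' [[x xE] [i iE] [j jE]]]]].
  (* Modulo [lucas b k.+1], the scalar [e] is the power l - 1 of [lucas b k.+2]; for l = 0 this is
     the inverse of [lucas b k.+2], which is its own inverse. *)
  exists (lucas b k.+2), (lucas b k.+2); rewrite muln0; split.
  - by exists y; lia.
  - by exists 0.
  - by exists (- y); rewrite lucas1; lia.
exists (e * lucas b k.+2), (e' * lucas b k.+2).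
rewrite mulnS [(k.+1 + _)%N]addnC; move: (k.+1 * l)%N iE jE => n iE jE.
rewrite lucasD addnS lucasD.
have {}iE : lucas b n = Z.of_nat l * e * lucas b k.+1 + i * lucas b k.+1 ^ 2 by lia.
have {}jE : lucas b n.+1 = e * lucas b k.+2 + j * lucas b k.+1 by lia.
have {}xE : e * e' = 1 + x * lucas b k.+1 by lia.
have {}yE : lucas b k.+2 ^ 2 = 1 + y * lucas b k.+1 by lia.
rewrite iE jE Nat2Z.inj_succ; split.
- exists (x + y + x * y * lucas b k.+1).
  have -> : e * lucas b k.+2 * (e' * lucas b k.+2) = (e * e') * lucas b k.+2 ^ 2 by ring.
  by rewrite xE yE; ring.
- exists (j - i * lucas b k - Z.of_nat l * e * b).
  by rewrite lucasSS; ring.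
- by exists (j * lucas b k.+2 - Z.of_nat l * e * lucas b k.+1 - i * lucas b k.+1 ^ 2); ring.
Qed.

(** By [lucasD], the term at m is a unit times the term at m - k modulo [lucas b k], so the index
    can be lowered by k. Among the indices below k only 0 gives a multiple. *)
Lemma lucas_dvd_idx b k m : 2 <= b -> (0 < k)%N ->
  (lucas b k | lucas b m) -> (k %| m)%N.
Proof.
case: k => // k b2 _; elim/ltn_ind: m => m IH.
case: (ltnP m k.+1) => [mk|km].
  case: m mk {IH} => [|m] mk; first by rewrite dvdn0.
  move/Z.divide_pos_le => H.
  have := lucas_incr m b2; have := lucas_incr m.+1 b2.
  have := lucas_mono b2 mk; lia.
move=> [q qE].
rewrite -(subnK km) dvdn_addl //; apply: IH; first lia.
have [y yE] := lucas_sqr_mod b k.+1.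
move: qE; rewrite -{1}(subnK km) addnS lucasD.
move: (lucas b (m - k.+1)) (lucas b (m - k.+1).+1) => z w qE.
(* modulo [lucas k.+1], [lucas k = - lucas k.+2] is invertible *)
have {}yE : lucas b k.+2 * lucas b k.+2 = 1 + y * lucas b k.+1 by lia.
have {}qE : z * lucas b k = (w - q) * lucas b k.+1 by lia.
exists (z * b * lucas b k.+2 - (w - q) * lucas b k.+2 - z * y).
have: z * (lucas b k.+2 * lucas b k.+2) =
  z * b * lucas b k.+1 * lucas b k.+2 - (z * lucas b k) * lucas b k.+2.
  by rewrite {1}lucasSS; ring.
by rewrite yE qE; lia.
Qed.

(** With m = k l, [lucas_mul] shows that [lucas b k] divides l e, where e is a unit. *)
Lemma lucas_sqr_dvd_idx b k m : 2 <= b -> (0 < k)%N ->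
  (lucas b k ^ 2 | lucas b m) -> (lucas b k | Z.of_nat m).
Proof.
case: k => // k b2 _ [q qE].
have [|l lE] := dvdnP (@lucas_dvd_idx b k.+1 m b2 isT _).
  by exists (q * lucas b k.+1); lia.
have [e [e' [[x xE] [i iE] _]]] := lucas_mul b k l.
have a0 : lucas b k.+1 <> 0 by have := lucas_incr k b2; lia.
rewrite mulnC -lE qE in iE.
have H : Z.of_nat l * e = (q - i) * lucas b k.+1 by nia.
exists (((q - i) * e' - x * Z.of_nat l) * Z.of_nat k.+1).
rewrite lE Nat2Z.inj_mul -!Z.mul_assoc [Z.of_nat k.+1 * _]Z.mul_comm !Z.mul_assoc.
congr (_ * _).
have : Z.of_nat l * e * e' = (q - i) * lucas b k.+1 * e' by rewrite H.
have {}xE : e * e' = 1 + x * lucas b k.+1 by lia.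
by rewrite -Z.mul_assoc xE; lia.
Qed.

Lemma lucas_sqr_dvd b k : 2 <= b -> exists2 m, (0 < m)%N &
  (lucas b k.+1 ^ 2 | lucas b m).
Proof.
move=> b2; have a1 : 1 <= lucas b k.+1 by have := lucas_incr k b2; lia.
(* With this l the term l e [lucas b k.+1] of [lucas_mul] is a multiple of the square. *)
pose l := Z.to_nat (lucas b k.+1).
exists (k.+1 * l)%N; first by rewrite muln_gt0 /=; rewrite /l; lia.
have [e [e' [_ [i iE] _]]] := lucas_mul b k l.
exists (i + e); rewrite {2}/l Z2Nat.id in iE; lia.
Qed.

(* [lucas m.+1 - lucas m.-1] is the trace of the [m]-th power of the companion matrix. *)
Definition lucas_trace b m := lucas b m.+1 - lucas b m.-1.

(** With a and 1/a the roots of X^2 - b X + 1, this expands (a^m + a^-m)(a^j - a^-j). *)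
Lemma lucas_reflect b m j : (0 < m)%N -> (j <= m)%N ->
  lucas b (m + j) = lucas b (m - j) + lucas_trace b m * lucas b j.
Proof.
case: m => // m _.
suff H : ((j <= m.+1)%N -> lucas b (m.+1 + j) =
       lucas b (m.+1 - j) + lucas_trace b m.+1 * lucas b j) /\
     ((j < m.+1)%N -> lucas b (m.+1 + j.+1) =
       lucas b (m.+1 - j.+1) + lucas_trace b m.+1 * lucas b j.+1) by apply H.
elim: j => [|j [IH1 IH2]].
  split=> _; first by rewrite addn0 subn0; rewrite ?lucas0 ?lucas1; ring.
  rewrite addn1 subn1 /lucas_trace -[m.+1.-1]/m lucas1; ring.
split=> [/IH2 //|jm]; rewrite !addnS lucasSS -addnS IH1 ?IH2; try lia.
have -> : (m.+1 - j = (m.+1 - j.+2).+2)%N by lia.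
have -> : (m.+1 - j.+1 = (m.+1 - j.+2).+1)%N by lia.
by rewrite !lucasSS; ring.
Qed.

(** Cayley-Hamilton for the m-th power of the companion matrix, whose determinant is 1. Modulo the
    trace, a shift by 2 m only changes the sign. *)
Lemma lucas_antiperiod b m n : (0 < m)%N ->
  lucas b (n + m.*2) = lucas_trace b m * lucas b (n + m) - lucas b n.
Proof.
move=> m0.
suff [] : lucas b (n + m.*2) = lucas_trace b m * lucas b (n + m) - lucas b n /\
  lucas b (n.+1 + m.*2) = lucas_trace b m * lucas b (n.+1 + m) - lucas b n.+1 by [].
elim: n => [|n [IH1 IH2]].
  split.
    by rewrite !add0n -addnn lucas_reflect // subnn; rewrite ?lucas0 ?lucas1; ring.
  case: m m0 => // m _; rewrite !add1n -addnn lucasD /lucas_trace -[m.+1.-1]/m.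
  have := lucas_pell b m; rewrite lucas1 lucasSS; lia.
split=> //; rewrite !addSn !lucasSS -!addSn IH2 IH1; ring.
Qed.

(** Anti-periodicity brings the index down to at most 2 m, then reflection in m to at most m; the
    value and the index pick up separate signs. *)
Lemma lucas_fold b m n : (0 < m)%N -> exists j s t,
  [/\ (j <= m)%N, s = 1 \/ s = -1, t = 1 \/ t = -1,
      eqZ (lucas_trace b m) (lucas b n) (s * lucas b j) &
      eqZ (Z.of_nat m) (Z.of_nat n) (t * Z.of_nat j)].
Proof.
move=> m0; elim/ltn_ind: n => n IH.
case: (leqP n m) => [nm|mn].
  exists n, 1, 1; split; [by []|by left|by left| |]; exists 0; ring.
case: (leqP n m.*2) => [n2m|mn2].
  exists (m.*2 - n)%N, 1, (-1); split; [lia|by left|by right| |by exists 2; lia].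
  exists (lucas b (n - m)); have := @lucas_reflect b m (n - m) m0 ltac:(lia).
  have -> : (m + (n - m) = n)%N by lia.
  have -> : (m - (n - m) = m.*2 - n)%N by lia.
  lia.
have [|j [s [t [jm sE tE [x xE] [y yE]]]]] := IH (n - m.*2)%N; first lia.
exists j, (- s), t; split=> //; first lia; last by exists (y + 2); lia.
exists (lucas b (n - m) - x); have := @lucas_antiperiod b m (n - m.*2) m0.
have -> : (n - m.*2 + m.*2 = n)%N by lia.
have -> : (n - m.*2 + m = n - m)%N by lia.
lia.
Qed.

(** * Matiyasevich's system of conditions for Lucas terms *)

Lemma eqZ_small d x y : eqZ d x y -> Z.abs (x - y) < d -> x = y.
Proof. by move=> [k E] H; (have k0 : k = 0 by nia); subst k; lia. Qed.

(** The numbers u and s are terms, u divides the index of s, and v is the trace at that index.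
    Modulo v, x = [lucas w n] is [lucas b n], which folds to plus or minus [lucas b j]; modulo u it
    is n, hence plus or minus j. The size conditions turn these into a = [lucas b j] and c = j. *)
Lemma lucas_system_sound b a c u t s r v w x y :
  4 <= b -> 0 <= a -> 0 <= t -> 0 <= r < s -> 0 <= x -> 0 <= y -> 2 <= w ->
  2 * a < u -> 2 * Z.of_nat c < u ->
  u ^ 2 - b * u * t + t ^ 2 = 1 -> s ^ 2 - b * s * r + r ^ 2 = 1 ->
  (u ^ 2 | s) -> v = b * s - 2 * r -> eqZ v w b -> eqZ u w 2 ->
  x ^ 2 - w * x * y + y ^ 2 = 1 -> eqZ v x a -> eqZ u x (Z.of_nat c) ->
  a = lucas b c.
Proof.
move=> b4 a0 t0 rs x0 y0 w2 au cu Pu Ps us vE wb w2u Px xa xc.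
have [k uE] := @pell_is_lucas b u t ltac:(lia) ltac:(lia) t0 Pu.
have [m [sE rE]] := pell_lucas (ltac:(lia) : 2 <= b) rs Ps.
have [n xE] := pell_is_lucas w2 x0 y0 Px.
have k0 : (0 < k)%N by case: k uE => // uE; rewrite lucas0 in uE; lia.
have um : (u | Z.of_nat m.+1).
  by rewrite uE; apply: lucas_sqr_dvd_idx; rewrite -?uE -?sE //; lia.
have vT : v = lucas_trace b m.+1.
  by rewrite vE /lucas_trace lucasSS -sE -[m.+1.-1]/m -rE; ring.
have [j [e [f [jm eE fE nv nm]]]] := @lucas_fold b m.+1 n isT.
have us_le : u <= s by have := Z.divide_pos_le _ _ _ us; nia.
have js : lucas b j <= s by rewrite sE; apply: lucas_mono => //; lia.
have j0 : Z.of_nat j <= lucas b j by apply: lucas_ge; lia.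
have av : a = e * lucas b j.
  (* As b >= 4, v = b s - 2 r exceeds 2 s, while a and [lucas b j] sum to less than 2 s. *)
  apply: (@eqZ_small v); last by nia.
  apply: eqZ_trans (eqZ_sym xa) _; rewrite xE.
  by apply: eqZ_trans (lucas_eqZ n wb) _; rewrite vT.
have aE : a = lucas b j by lia.
rewrite aE; congr lucas; apply: Nat2Z.inj.
suff : Z.of_nat c = f * Z.of_nat j by lia.
(* Both c and j are below u / 2, since j is at most [lucas b j] = a. *)
apply: (@eqZ_small u); last by lia.
apply: eqZ_trans (eqZ_sym xc) _; rewrite xE.
apply: eqZ_trans (lucas_eqZ n w2u) _; rewrite lucas2.
exact: Z.divide_trans um nm.
Qed.

(** Consecutive terms are coprime, hence not both even. Oddness serves to make u and v coprime in
    the completeness proof. *)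
Lemma lucas_odd_large b N : 2 <= b -> exists k,
  Z.of_nat N < lucas b k.+1 /\ Z.Odd (lucas b k.+1).
Proof.
move=> b2; have HN := @lucas_ge b N.+1 b2.
have [E|O] := Z.Even_or_Odd (lucas b N.+1); last by exists N; split=> //; lia.
exists N.+1; have := lucas_incr N.+1 b2; split; first lia.
have [[p pE]|//] := Z.Even_or_Odd (lucas b N.+2).
case: E => q qE; have [||z zE] := @lucas_coprime b N.+1 2; last lia.
  by exists q; lia.
by exists p; lia.
Qed.

Lemma lucas_system_complete b c : 4 <= b -> exists u t s r v w x y,
  let a := lucas b c in
  [/\ [/\ 0 <= t, 0 <= r < s, 0 <= x, 0 <= y & 2 <= w],
      [/\ 2 * a < u, 2 * Z.of_nat c < u, u ^ 2 - b * u * t + t ^ 2 = 1,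
          s ^ 2 - b * s * r + r ^ 2 = 1 & (u ^ 2 | s)],
      v = b * s - 2 * r, [/\ eqZ v w b & eqZ u w 2] &
      [/\ x ^ 2 - w * x * y + y ^ 2 = 1, eqZ v x a & eqZ u x (Z.of_nat c)]].
Proof.
move=> b4; have b2 : 2 <= b by lia.
have a0 : 0 <= lucas b c by have := lucas_incr c b2; lia.
have ac := @lucas_ge b c b2.
have [k [ku uodd]] := lucas_odd_large (Z.to_nat (2 * lucas b c)) b2.
have [m m0 us] := lucas_sqr_dvd k b2.
case: m m0 us => // m _ us.
have rs := lucas_incr m b2; have k1 := lucas_incr k b2.
pose u := lucas b k.+1; pose s := lucas b m.+1; pose r := lucas b m.
pose v := b * s - 2 * r.
have Ps : s ^ 2 - b * s * r + r ^ 2 = 1 by apply: lucas_pell.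
have v0 : 0 < v by rewrite /v /s /r; nia.
have [p [q pq]] : exists p q, p * u + q * v = 1.
  have Hg := Z.gcd_divide_l u v; have Hg' := Z.gcd_divide_r u v.
  have g1 : Z.gcd u v = 1.
    (* Modulo the gcd, s = 0 as u divides s, then 2 r = 0 as v = b s - 2 r, and twice the Pell
       equation of s and r leaves 2 = 0. *)
    have : (Z.gcd u v | 2).
      have [i iE] := us; case: Hg' => i' i'E; case: Hg => j jE.
      exists (2 * i * u * j * (s - b * r) + r * (b * i * u * j - i')).
      have sE : s = i * u * j * Z.gcd u v by rewrite -!Z.mul_assoc -jE /s iE -/u; ring.
      have rE : 2 * r = b * s - i' * Z.gcd u v by rewrite -i'E /v; ring.
      transitivity (2 * (s - b * r) * (i * u * j * Z.gcd u v)
          + r * (b * (i * u * j * Z.gcd u v) - i' * Z.gcd u v)); last by ring.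
      by rewrite -sE -rE; lia.
    move=> g2; have g_le := @Z.divide_pos_le (Z.gcd u v) 2 ltac:(lia) g2.
    have g0 := Z.gcd_nonneg u v; case: g2 => z zE.
    case: uodd => h hE; case: Hg => j; rewrite {1}/u hE.
    move: (Z.gcd u v) zE g_le g0 => g zE g_le g0 jE.
    have [|[|]] : g = 0 \/ g = 1 \/ g = 2; first lia; move=> gE; subst g; lia.
  have [p [q pq]] := Z.gcd_bezout u v 1 g1; exists p, q; lia.
(* [w] is the Chinese remainder of b modulo v and 2 modulo u; adding [N] times u v makes it at least
   2. *)
pose N := Z.abs (b * p * u + 2 * q * v) + 2.
pose w := b * p * u + 2 * q * v + N * (u * v).
have uv : 1 <= u * v by rewrite /u; nia.
have w2 : 2 <= w by rewrite /w; nia.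
have wb : eqZ v w b by exists (2 * q - b * q + N * u); rewrite /w; nia.
have wu : eqZ u w 2 by exists (b * p - 2 * p + N * v); rewrite /w; nia.
have xw := lucas_incr c w2; have xw' := lucas_incr c.+1 w2.
exists u, (lucas b k), s, r, v, w, (lucas w c), (lucas w c.+1); split=> //.
- split; rewrite ?/r ?/s; lia.
- by split=> //; rewrite ?/u; try lia; have := lucas_pell b k; lia.
- split; [have := lucas_pell w c; lia | exact: lucas_eqZ|].
  by rewrite -(lucas2 c); apply: lucas_eqZ.
Qed.

End Lucas.

(** * Exponentiation *)

Lemma eqmod_eqZ d x y :
  x = y %[mod d] <-> eqZ (Z.of_nat d) (Z.of_nat x) (Z.of_nat y).
Proof.
rewrite eqmod_ex; split=> [[k [l E]]|[k E]].
  by exists (Z.of_nat l - Z.of_nat k)%Z; lia.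
exists (Z.to_nat (- k)), (Z.to_nat k); nia.
Qed.

Lemma dvdn_Zdivide d x : d %| x <-> (Z.of_nat d | Z.of_nat x)%Z.
Proof.
split=> [/dvdnP[k ->]|[k E]]; first by exists (Z.of_nat k); lia.
apply/dvdnP; exists (Z.to_nat k).
have [d0|d0] : d = 0 \/ 0 < d by lia.
  by subst d; lia.
nia.
Qed.

Lemma pell_nat b x y : x * x + y * y = b * x * y + 1 <->
  (Z.of_nat x ^ 2 - Z.of_nat b * Z.of_nat x * Z.of_nat y + Z.of_nat y ^ 2 = 1)%Z.
Proof. lia. Qed.

(* The shift by 4 makes the parameter admissible in [lucas_system_sound]. *)
Definition lucas_nat (b n : nat) : nat := Z.to_nat (lucas (Z.of_nat b + 4) n).

Lemma lucas_natE b n : Z.of_nat (lucas_nat b n) = lucas (Z.of_nat b + 4) n.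
Proof.
have := @lucas_incr (Z.of_nat b + 4) n ltac:(lia).
by rewrite /lucas_nat; lia.
Qed.

Lemma lucas_nat_system a b c : a = lucas_nat b c <->
  exists u t s r v w x y,
  2 * a < u /\ 2 * c < u /\ u * u + t * t = (b + 4) * u * t + 1 /\
  s * s + r * r = (b + 4) * s * r + 1 /\ r < s /\ u * u %| s /\
  v + 2 * r = (b + 4) * s /\ 2 <= w /\ w = b + 4 %[mod v] /\ w = 2 %[mod u] /\
  x * x + y * y = w * x * y + 1 /\ x = a %[mod v] /\ x = c %[mod u].
Proof.
have B4 : (Z.of_nat (b + 4) = Z.of_nat b + 4)%Z by lia.
split=> [->|].
  have [u [t [s [r [v [w [x [y []]]]]]]]] :=
    @lucas_system_complete (Z.of_nat b + 4) c ltac:(lia).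
  rewrite -lucas_natE {a}; move: (lucas_nat b c) => a.
  move=> [t0 rs x0 y0 w2] [au cu Pu Ps us] vE [wb w2u] [Px xa xc].
  exists (Z.to_nat u), (Z.to_nat t), (Z.to_nat s), (Z.to_nat r), (Z.to_nat v),
    (Z.to_nat w), (Z.to_nat x), (Z.to_nat y).
  have v0 : (0 <= v)%Z by nia.
  rewrite !pell_nat !eqmod_eqZ dvdn_Zdivide !Nat2Z.inj_mul B4 !Z2Nat.id; try lia.
  rewrite -Z.pow_2_r -[Z.of_nat 2]/(2%Z).
  by do !split=> //; lia.
move=> [u [t [s [r [v [w [x [y]]]]]]]].
rewrite !pell_nat !eqmod_eqZ dvdn_Zdivide !Nat2Z.inj_mul B4.
rewrite -Z.pow_2_r -[Z.of_nat 2]/(2%Z).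
move=> [au [cu [Pu [Ps [rs [us [vE [w2 [wb [w2u [Px [xa xc]]]]]]]]]]]].
apply: Nat2Z.inj; rewrite lucas_natE.
apply: (@lucas_system_sound _ _ c _ (Z.of_nat t) _ _ _ _ _ (Z.of_nat y)
  _ _ _ _ _ _ _ _ _ Pu Ps us _ wb w2u Px xa xc); lia.
Qed.

Lemma dio_lucas f g : dio_fun f -> dio_fun g ->
  dio_fun (fun v => lucas_nat (f v) (g v)).
Proof.
apply: dio_fun2.
apply: (dio_ext (fun v => iff_sym (lucas_nat_system (v 0) (v 1) (v 2)))).
dio.
Qed.

Ltac dio_head ::= apply: dio_lucas.

Section Power.
Local Open Scope Z_scope.

(** Modulo this number p is a root of X^2 - b X + 1, so its powers obey the recurrence of
    [lucas b]. *)
Lemma lucas_pow b p n :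
  eqZ (b * p - p ^ 2 - 1) (p ^ Z.of_nat n) (lucas b n.+1 - (b - p) * lucas b n).
Proof.
set d := (_ - 1).
suff [] : eqZ d (p ^ Z.of_nat n) (lucas b n.+1 - (b - p) * lucas b n) /\
  eqZ d (p ^ Z.of_nat n.+1) (lucas b n.+2 - (b - p) * lucas b n.+1) by [].
elim: n => [|n [[i IH1] [j IH2]]].
  rewrite lucasSS lucas0 lucas1 -[p ^ _]/(1) /d Z.pow_1_r.
  by split; exists 0; ring.
split; first by exists j.
exists (b * j - i - p ^ Z.of_nat n).
rewrite ![lucas b n.+3]lucasSS.
move: IH1 IH2; rewrite !Nat2Z.inj_succ !Z.pow_succ_r; try lia.
rewrite ![lucas b n.+2]lucasSS /d; move: (p ^ _) => q IH1 IH2.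
lia.
Qed.

End Power.

(** The congruence of [lucas_pow], freed of subtractions, determines p ^ n once the modulus exceeds
    it. The parameter [b] contains a Lucas term that is at least p ^ n by [lucas_geX]. For p = 0 no
    modulus [d] satisfies its equation. *)
Lemma exp_system p n q : q = p ^ n <->
  (p = 0 /\ n = 0 /\ q = 1) \/ (p = 0 /\ 0 < n /\ q = 0) \/
  (0 < p /\ exists b d, b = lucas_nat p n.+1 + p /\ d + p * p + 1 = (b + 4) * p /\
     q < d /\ q + (b + 4) * lucas_nat b n = lucas_nat b n.+1 + p * lucas_nat b n %[mod d]).
Proof.
have [->|p0] : p = 0 \/ 0 < p by lia.
  case: n => [|n]; rewrite ?expn0 ?exp0n //; split; try lia.
pose b := lucas_nat p n.+1 + p; pose d := (b + 4) * p - p * p - 1.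
have dE : d + p * p + 1 = (b + 4) * p by rewrite /d /b; nia.
have pd : p ^ n < d.
  have : p ^ n <= lucas_nat p n.+1.
    have := @lucas_geX (Z.of_nat p + 3) n ltac:(lia).
    rewrite -Z.add_assoc -[(3 + 1)%Z]/(4%Z) -lucas_natE.
    have := Z.pow_le_mono_l (Z.of_nat p) (Z.of_nat p + 3) (Z.of_nat n) ltac:(lia).
    lia.
  by rewrite /d /b; nia.
have pq : p ^ n + (b + 4) * lucas_nat b n =
    lucas_nat b n.+1 + p * lucas_nat b n %[mod d].
  rewrite eqmod_eqZ.
  have [i iE] := lucas_pow (Z.of_nat b + 4) (Z.of_nat p) n.
  exists i; rewrite !Nat2Z.inj_add !Nat2Z.inj_mul !lucas_natE.
  have -> : Z.of_nat d = ((Z.of_nat b + 4) * Z.of_nat p - Z.of_nat p ^ 2 - 1)%Z by lia.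
  by rewrite -iE; lia.
split=> [->|].
  right; right; split=> //; exists b, d; split=> //; split=> //; split=> //.
case=> [[p1 _]|[[p1 _]|[_ [b' [d' [-> [dE' [qd E]]]]]]]]; try by rewrite p1 in p0.
have d'd : d' = d by move: dE'; rewrite -/b -dE -!addnA => /addIn.
move: E qd; rewrite d'd -/b -[in RHS]pq => /eqP E qd; move: E.
by rewrite ![_ + (b + 4) * _]addnC eqn_modDl !modn_small // => /eqP.
Qed.

Lemma dio_exp f g : dio_fun f -> dio_fun g -> dio_fun (fun v => f v ^ g v).
Proof.
apply: dio_fun2.
apply: (dio_ext (fun v => iff_sym (exp_system (v 1) (v 2) (v 0)))).
dio.
Qed.

Ltac dio_head ::= first [apply: dio_exp | apply: dio_lucas].

(** * Digits, binomials and factorials *)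

Lemma dio_divn f g : dio_fun f -> dio_fun g -> dio_fun (fun v => f v %/ g v).
Proof.
apply: dio_fun2.
apply: (dio_ext (S := fun v => (v 2 = 0 /\ v 0 = 0) \/
   (v 0 * v 2 <= v 1 /\ v 1 < (v 0).+1 * v 2))) => [v|]; last by dio.
have [->|d0] := posnP (v 2); first by rewrite divn0; lia.
split=> [|->]; last by right; rewrite leq_divM ltn_ceil.
case=> [|[h1 h2]]; first lia.
by apply/eqP; rewrite eqn_leq leq_divRL // h1 -ltnS ltn_divLR // h2.
Qed.

Lemma dio_modn f g : dio_fun f -> dio_fun g -> dio_fun (fun v => f v %% g v).
Proof.
apply: dio_fun2.
apply: (dio_ext (S := fun v => (v 2 = 0 /\ v 0 = v 1) \/
   (v 0 < v 2 /\ v 0 = v 1 %[mod v 2]))) => [v|]; last by dio.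
have [->|d0] := posnP (v 2); first by rewrite modn0; lia.
split=> [|->]; last by right; rewrite ltn_pmod // modn_mod.
by case=> [|[h1 <-]]; [lia | rewrite modn_small].
Qed.

Definition digit (b c i : nat) := (c %/ b ^ i) %% b.

Lemma digit_sum b m (d : nat -> nat) k : (forall i, d i < b) ->
  digit b (\sum_(i < m) d i * b ^ i) k = if k < m then d k else 0.
Proof.
rewrite /digit; elim: k m d => [|k IHk] [|m] d db;
  rewrite ?big_ord0 ?div0n ?mod0n // big_ord_recl /= expn0 muln1.
- have E : \sum_(i < m) d (bump 0 i) * b ^ bump 0 i =
           (\sum_(i < m) d i.+1 * b ^ i) * b.
    by rewrite big_distrl; apply: eq_bigr => i _; rewrite /= /bump expnSr mulnA.
  by rewrite E divn1 addnC modnMDl modn_small.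
- have E : \sum_(i < m) d (bump 0 i) * b ^ bump 0 i =
           (\sum_(i < m) d i.+1 * b ^ i) * b.
    by rewrite big_distrl; apply: eq_bigr => i _; rewrite /= /bump expnSr mulnA.
  have b0 : 0 < b by have := db 0; lia.
  rewrite E expnS divnMA addnC divnMDl // (divn_small (db 0)) addn0.
  by rewrite (IHk _ (fun i => d i.+1)).
Qed.

Lemma bin_leX n k : 'C(n, k) <= 2 ^ n.
Proof.
elim: n k => [|n IHn] [|k] //; first by rewrite bin0 expn_gt0.
by rewrite binS expnS mul2n -addnn leq_add.
Qed.

(** The binomial theorem read in base B = 2 ^ n + 1 for (1 + B) ^ n: every coefficient is below
    B. *)
Lemma bin_digit n k : 'C(n, k) = digit (2 ^ n).+1 ((2 ^ n).+2 ^ n) k.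
Proof.
rewrite -[(2 ^ n).+2]add1n expnDn.
under eq_bigr => i _ do rewrite exp1n mul1n.
rewrite (@digit_sum _ _ (fun i => 'C(n, i))) => [|i]; last by rewrite ltnS bin_leX.
by case: leqP => // nk; rewrite bin_small.
Qed.

Lemma dio_bin f g : dio_fun f -> dio_fun g -> dio_fun (fun v => 'C(f v, g v)).
Proof.
move=> Df Dg; apply: (dio_funext (fun v => esym (bin_digit (f v) (g v)))).
rewrite /digit; apply: dio_modn; last by dio.
by apply: dio_divn; dio.
Qed.

Lemma ffact_leX r w : r ^_ w <= r ^ w.
Proof.
elim: w => [|w IHw] //.
by rewrite ffactnSr expnSr leq_mul // leq_subr.
Qed.

(** The falling factorial misses r ^ w by at most the fraction w^2 / r of it. *)
Lemma ffact_geX r w : r ^ w * r <= r ^_ w * r + r ^ w * w * w.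
Proof.
elim: w => [|w IHw]; first by rewrite ffactn0; lia.
rewrite ffactnSr expnSr; move: (r ^ w) (r ^_ w) IHw => x y IHw.
have [rw|wr] := leqP r w; first by nia.
have [a aE] : exists a, r = a + w by exists (r - w); lia.
have -> : r - w = a by lia.
have : x * r * a <= (y * r + x * w * w) * a by rewrite leq_mul2r IHw orbT.
by subst r; nia.
Qed.

Lemma fact_leX w : w`! <= w ^ w.
Proof. by rewrite -ffactnn ffact_leX. Qed.

(** Before rounding, the quotient is w! times r ^ w over the falling factorial; by [ffact_geX] it is
    below w! + 1 when (w! + 1) w^2 < r. The bound on r has w ^ w in place of w! because powers are
    already Diophantine. *)
Lemma fact_div_bin w r : (w ^ w).+1 * w * w < r -> w`! = r ^ w %/ 'C(r, w).
Proof.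
move=> rw; have wr : w <= r by nia.
have C0 : 0 < 'C(r, w) by rewrite bin_gt0.
have fw := fact_leX w; have f0 := fact_gt0 w.
apply/eqP; rewrite eqn_leq leq_divRL // mulnC bin_ffact ffact_leX /=.
rewrite -ltnS ltn_divLR // -(ltn_pmul2r f0) -mulnA bin_ffact.
have r0 : 0 < r by lia.
rewrite -(ltn_pmul2r r0).
have := ffact_geX r w; have : 0 < r ^ w by rewrite expn_gt0 r0.
move: (r ^ w) (r ^_ w) => x y x0 H.
have : (w`!).+1 * (x * r) <= (w`!).+1 * (y * r + x * w * w) by rewrite leq_mul2l H orbT.
have : x * ((w`!).+1 * w * w) < x * r.
  by rewrite ltn_pmul2l //; apply: leq_ltn_trans rw; rewrite !leq_mul.
lia.
Qed.

Lemma dio_fact f : dio_fun f -> dio_fun (fun v => (f v)`!).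
Proof.
move=> Df; pose r v := ((f v ^ f v).+1 * f v * f v).+1.
apply: (dio_funext (f := fun v => r v ^ f v %/ 'C(r v, f v))) => [v|].
  by rewrite -fact_div_bin.
by apply: dio_divn; last apply: dio_bin; rewrite /r; dio.
Qed.

Ltac dio_head ::=
  lazymatch goal with
  | |- dio_fun (fun v => binomial _ _) => apply: dio_bin
  | |- dio_fun (fun v => factorial _) => apply: dio_fact
  | |- dio_fun (fun v => divn _ _) => apply: dio_divn
  | |- dio_fun (fun v => modn _ _) => apply: dio_modn
  | |- dio_fun (fun v => expn _ _) => apply: dio_exp
  end.

(** * Formulas modulo a product of coprime moduli *)

Lemma eqmod_dvd d m x y : d %| m -> x = y %[mod m] -> x = y %[mod d].
Proof. by move=> dm xy; rewrite -(modn_dvdm x dm) xy modn_dvdm. Qed.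

Lemma eqmod_cancel p g x y : prime p -> ~~ (p %| g) ->
  g * x = g * y %[mod p] -> x = y %[mod p].
Proof.
move=> pp pg; wlog yx : x y / y <= x => [H|].
  by have [/H//|/ltnW/H{}H /esym/H] := leqP y x.
move/eqP; rewrite eqn_mod_dvd ?leq_mul2l ?yx ?orbT // -mulnBr Euclid_dvdM //.
by rewrite (negbTE pg) /= -eqn_mod_dvd // => /eqP.
Qed.

(** * Chinese remaindering for finite families of moduli *)

Section Moduli.
Variable m : nat -> nat.

Lemma coprime_prod n d : (forall i, i < n -> coprime (m i) d) ->
  coprime (\prod_(i < n) m i) d.
Proof.
move=> H; apply: (big_ind (fun x => coprime x d)) => [|x y Hx Hy|i _].
- exact: coprime1n.
- by rewrite coprimeMl Hx.
- exact: H.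
Qed.

Definition pairwise_coprime n := forall i j, i < j < n -> coprime (m i) (m j).

Lemma pairwise_coprimeS n : pairwise_coprime n.+1 ->
  pairwise_coprime n /\ coprime (\prod_(i < n) m i) (m n).
Proof.
move=> H; split=> [i j /andP[ij jn]|]; first by apply: H; rewrite ij leqW.
by apply: coprime_prod => i lt_in; apply: H; rewrite lt_in /=.
Qed.

Lemma prod_dvd n d : pairwise_coprime n -> (forall i, i < n -> m i %| d) ->
  \prod_(i < n) m i %| d.
Proof.
elim: n => [|n IHn] C H; first by rewrite big_ord0 dvd1n.
have [Cn Cm] := pairwise_coprimeS C.
rewrite big_ord_recr /= Gauss_dvd // H // IHn // => i lt_in.
by apply: H; rewrite ltnW.
Qed.

Lemma dvd_prod n i : i < n -> m i %| \prod_(i < n) m i.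
Proof.
by move=> lt_in; rewrite (bigD1 (Ordinal lt_in)) //= dvdn_mulr.
Qed.

Lemma eqmod_prod n x y : pairwise_coprime n ->
  (forall i, i < n -> x = y %[mod m i]) -> x = y %[mod \prod_(i < n) m i].
Proof.
move=> C; wlog yx : x y / y <= x => [H|].
  have [/H//|/ltnW/H{}H E] := leqP y x.
  by apply/esym/H => i /E.
move=> E; apply/eqP; rewrite eqn_mod_dvd //; apply: prod_dvd => // i /E/eqP.
by rewrite eqn_mod_dvd.
Qed.

(** The residues are picked one at a time along the induction, which avoids a choice function. *)
Lemma chinese_exists n (P : nat -> nat -> Prop) : pairwise_coprime n ->
  (forall i, i < n -> exists a, P i a) ->
  exists x, forall i, i < n -> exists2 a, P i a & x = a %[mod m i].
Proof.
elim: n => [|n IHn] C H; first by exists 0.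
have [Cn Cm] := pairwise_coprimeS C.
have [i lt_in|x Hx] := IHn Cn; first by apply: H; rewrite ltnW.
have [a Pa] := H n (ltnSn n).
exists (chinese (\prod_(i < n) m i) (m n) x a) => i.
rewrite ltnS leq_eqVlt => /orP[/eqP->|lt_in].
  by exists a => //; rewrite chinese_modr.
have [b Pb E] := Hx i lt_in; exists b => //; rewrite -E.
by apply: eqmod_dvd (dvd_prod lt_in) _; rewrite chinese_modl.
Qed.

End Moduli.

(** Each [X j] carries one value per coprime divisor of [M], as its remainder. [g] is the product of
    the multipliers of the enclosing disjunctions; atoms are void modulo the divisors of [g]. *)
Fixpoint crt_sem (M u g : nat) (A : dio_formula) (X : valuation) : Prop :=
  match A with
  | dio_eq_cst i n => g * X i = g * n %[mod M]
  | dio_eq_var i j => g * X i = g * X j %[mod M]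
  | dio_eq_add i j k => g * X i = g * (X j + X k) %[mod M]
  | dio_eq_mul i j k => g * X i = g * (X j * X k) %[mod M]
  | dio_and A B => crt_sem M u g A X /\ crt_sem M u g B X
  | dio_or A B => exists e1 e2, e1 + e2 = 1 %[mod M] /\
      crt_sem M u (g * e1) A X /\ crt_sem M u (g * e2) B X
  | dio_exists A => exists x, M %| 'C(x, u.+1) /\ crt_sem M u g A (val_cons x X)
  end.

Lemma crt_sem_ext M u g A X Y :
  X =1 Y -> crt_sem M u g A X <-> crt_sem M u g A Y.
Proof.
elim: A g X Y => [i n|i j|i j k|i j k|A IHA B IHB|A IHA B IHB|A IHA] g X Y XY /=;
  rewrite ?XY //.
- by rewrite (IHA _ _ _ XY) (IHB _ _ _ XY).
- by split=> -[e1 [e2 [E [H1 H2]]]]; exists e1, e2; split=> //; split;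
    [apply/(IHA _ _ _ XY)|apply/(IHB _ _ _ XY)|apply/(IHA _ _ _ XY)|apply/(IHB _ _ _ XY)].
- have E n : val_cons n X =1 val_cons n Y by case.
  by split=> -[n [D H]]; exists n; split=> //; apply/(IHA _ _ _ (E n)).
Qed.

Lemma dio_crt_sem A fM fu fg (F : nat -> valuation -> nat) :
  dio_fun fM -> dio_fun fu -> dio_fun fg -> (forall i, dio_fun (F i)) ->
  dio_rel (fun v => crt_sem (fM v) (fu v) (fg v) A (fun i => F i v)).
Proof.
elim: A fM fu fg F => [i n|i j|i j k|i j k|A IHA B IHB|A IHA B IHB|A IHA] fM fu fg F
  DM Du Dg DF /=.
- by have Di := DF i; dio.
- by have Di := DF i; have Dj := DF j; dio.
- by have Di := DF i; have Dj := DF j; have Dk := DF k; dio.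
- by have Di := DF i; have Dj := DF j; have Dk := DF k; dio.
- by apply: dio_conj; [apply: IHA | apply: IHB].
- have lift2 f : dio_fun f -> dio_fun (fun v => f (val_up (val_up v))).
    by move=> Df; exact: dio_funup (dio_funup Df).
  apply: dio_ex; apply: dio_ex; apply: dio_conj.
    have := lift2 _ DM; rewrite /val_up => DM2; dio.
  apply: dio_conj.
    apply: (IHA (fun v => fM (val_up (val_up v))) (fun v => fu (val_up (val_up v)))
        (fun v => fg (val_up (val_up v)) * v 1) (fun i v => F i (val_up (val_up v))));
      try by [apply: lift2 | move=> i; apply: lift2].
    by apply: dio_mul; [apply: lift2 | apply: dio_var].
  apply: (IHB (fun v => fM (val_up (val_up v))) (fun v => fu (val_up (val_up v)))
        (fun v => fg (val_up (val_up v)) * v 0) (fun i v => F i (val_up (val_up v))));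
      try by [apply: lift2 | move=> i; apply: lift2].
  by apply: dio_mul; [apply: lift2 | apply: dio_var].
- apply: dio_ex; apply: dio_conj.
    apply: dio_dvd; first exact: dio_funup.
    by apply: dio_bin; [apply: dio_var | exact: dio_succ (dio_funup Du)].
  pose F' i v := if i is j.+1 then F j (val_up v) else v 0.
  apply: (dio_ext (S := fun v => crt_sem (fM (val_up v)) (fu (val_up v))
      (fg (val_up v)) A (fun i => F' i v))) => [v|].
    by apply: crt_sem_ext; case.
  apply: (IHA (fun v => fM (val_up v)) (fun v => fu (val_up v)) (fun v => fg (val_up v)));
    try exact: dio_funup.
  by case=> [|i]; [apply: dio_var | apply: dio_funup].
Qed.

(** * Soundness and completeness of the semantics modulo M *)

Fixpoint dio_fv (A : dio_formula) : nat :=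
  match A with
  | dio_eq_cst i n => i.+1
  | dio_eq_var i j => maxn i.+1 j.+1
  | dio_eq_add i j k | dio_eq_mul i j k => maxn i.+1 (maxn j.+1 k.+1)
  | dio_and A B | dio_or A B => maxn (dio_fv A) (dio_fv B)
  | dio_exists A => (dio_fv A).-1
  end.

Fixpoint dio_max_cst (A : dio_formula) : nat :=
  match A with
  | dio_eq_cst i n => n
  | dio_and A B | dio_or A B => maxn (dio_max_cst A) (dio_max_cst B)
  | dio_exists A => dio_max_cst A
  | _ => 0
  end.

Lemma prime_dvd_ffact p x u : prime p -> p %| x ^_ u.+1 ->
  exists2 r, r <= u & x = r %[mod p].
Proof.
move=> pp; elim: u => [|u IHu].
  by rewrite ffactn1 => /eqP E; exists 0; rewrite // mod0n.
rewrite ffactnSr Euclid_dvdM // => /orP[/IHu[r ru E]|D].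
  by exists r => //; apply: leqW.
(* Where the subtraction truncates, x itself is the small representative. *)
have [xu|ux] := leqP x u.+1; first by exists x.
by exists u.+1 => //; apply/eqP; rewrite eqn_mod_dvd // ltnW.
Qed.

(** One large prime factor of [M] is enough: [g] cancels modulo p, and values, constants, sums and
    products all stay below p, so congruences are equalities. *)
Lemma crt_sem_sound p M u g A X w k :
  prime p -> p %| M -> u.+1 ^ 2 < p -> ~~ (p %| g) ->
  dio_fv A <= k -> dio_max_cst A <= u ->
  (forall j, j < k -> w j <= u /\ X j = w j %[mod p]) ->
  crt_sem M u g A X -> dio_sem A w.
Proof.
move=> pp pM up; have [up1 up2 up3] : [/\ u < p, u + u < p & u * u < p].
  by move: up; rewrite -mulnn; clear; split; nia.
have eqp x y : x < p -> y < p -> x = y %[mod p] -> x = y.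
  by move=> xp yp; rewrite !modn_small.
elim: A g X w k => [i n|i j|i j l|i j l|A IHA B IHB|A IHA B IHB|A IHA] g X w k pg /=;
  rewrite ?geq_max.
- move=> ik nu /(_ i ik)[wi Xi] /(eqmod_dvd pM) /(eqmod_cancel pp pg) E.
  by apply: eqp; [exact: leq_ltn_trans up1 | exact: leq_ltn_trans up1 | rewrite -Xi].
- move=> /andP[ik jk] _ H /(eqmod_dvd pM) /(eqmod_cancel pp pg) E.
  have [wi Xi] := H i ik; have [wj Xj] := H j jk.
  by apply: eqp; [exact: leq_ltn_trans up1 | exact: leq_ltn_trans up1 | rewrite -Xi -Xj].
- move=> /and3P[ik jk lk] _ H /(eqmod_dvd pM) /(eqmod_cancel pp pg) E.
  have [wi Xi] := H i ik; have [wj Xj] := H j jk; have [wl Xl] := H l lk.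
  apply: eqp; [exact: leq_ltn_trans up1 | exact: leq_ltn_trans (leq_add wj wl) up2 |].
  by rewrite -Xi -[RHS]modnDm -Xj -Xl modnDm.
- move=> /and3P[ik jk lk] _ H /(eqmod_dvd pM) /(eqmod_cancel pp pg) E.
  have [wi Xi] := H i ik; have [wj Xj] := H j jk; have [wl Xl] := H l lk.
  apply: eqp; [exact: leq_ltn_trans up1 | exact: leq_ltn_trans (leq_mul wj wl) up3 |].
  by rewrite -Xi -[RHS]modnMm -Xj -Xl modnMm.
- move=> /andP[Ak Bk] /andP[Au Bu] H [SA SB].
  by split; [apply: IHA H SA | apply: IHB H SB].
- move=> /andP[Ak Bk] /andP[Au Bu] H [e1 [e2 [/(eqmod_dvd pM) E [SA SB]]]].
  have [pe1|pe1] := boolP (p %| e1); last first.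
    by left; apply: IHA H SA => //; rewrite Euclid_dvdM // negb_or pg.
  right; apply: IHB H SB => //; rewrite Euclid_dvdM // negb_or pg /=.
  apply/negP => pe2; have : p %| 1 by rewrite /dvdn -E -/(dvdn _ _) dvdn_add.
  by rewrite Euclid_dvd1.
- move=> Ak Au H [x [D SA]].
  have [|r ru E] := @prime_dvd_ffact p x u pp.
    by rewrite -bin_ffact dvdn_mulr // (dvdn_trans pM).
  exists r; apply: (IHA g (val_cons x X) _ k.+1 pg _ Au _ SA).
    by case: (dio_fv A) Ak.
  by case=> [|j] /= jk; [|apply: H].
Qed.

(** [crt_sem] has a single bound [u], so completeness starts from truth with all witnesses bounded
    by it. *)
Fixpoint dio_bsem (u : nat) (A : dio_formula) (v : valuation) : Prop :=
  match A with
  | dio_and A B => dio_bsem u A v /\ dio_bsem u B v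
  | dio_or A B => dio_bsem u A v \/ dio_bsem u B v
  | dio_exists A => exists2 n, n <= u & dio_bsem u A (val_cons n v)
  | _ => dio_sem A v
  end.

Lemma dio_bsem_mono u u' A v : u <= u' -> dio_bsem u A v -> dio_bsem u' A v.
Proof.
move=> uu; elim: A v => //= [A IHA B IHB|A IHA B IHB|A IHA] v.
- by move=> [/IHA ? /IHB].
- by move=> [/IHA|/IHB]; [left|right].
- by move=> [n nu /IHA]; exists n => //; apply: leq_trans uu.
Qed.

Lemma dio_sem_bsem A v : dio_sem A v -> exists u, dio_bsem u A v.
Proof.
elim: A v => /= [i n|i j|i j k|i j k|A IHA B IHB|A IHA B IHB|A IHA] v;
  try by exists 0.
- move=> [/IHA[a Aa] /IHB[b Bb]]; exists (maxn a b).
  by split; [apply: dio_bsem_mono Aa|apply: dio_bsem_mono Bb]; rewrite ?leq_maxl ?leq_maxr.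
- by move=> [/IHA[a Aa]|/IHB[b Bb]]; [exists a; left|exists b; right].
- move=> [n /IHA[a Aa]]; exists (maxn n a); exists n; first exact: leq_maxl.
  exact: dio_bsem_mono (leq_maxr _ _) Aa.
Qed.

Lemma dio_sem_bsem_uniform A n (w : nat -> valuation) N :
  (forall i, i < n -> dio_sem A (w i)) ->
  exists2 u, N <= u & forall i, i < n -> dio_bsem u A (w i).
Proof.
elim: n => [|n IHn] H; first by exists N.
have [i ?|u Nu Hu] := IHn; first by apply: H; rewrite ltnW.
have [a Ha] := dio_sem_bsem (H n (ltnSn n)).
exists (maxn u a); first by rewrite (leq_trans Nu) // leq_maxl.
move=> i; rewrite ltnS leq_eqVlt => /orP[/eqP->|/Hu]; [move: Ha|];
  by apply: dio_bsem_mono; rewrite ?leq_maxl ?leq_maxr.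
Qed.

(** Chinese remaindering glues the choices made at each modulus, of a branch or of a witness, into
    single numbers. Where a modulus divides [g] the branch was not taken and nothing is required. *)
Lemma crt_sem_complete m n u g A X k : pairwise_coprime m n ->
  (forall i, i < n -> u < m i /\ coprime (m i) u.+1`!) ->
  dio_fv A <= k ->
  (forall i, i < n -> m i %| g \/
     exists2 w, forall j, j < k -> X j = w j %[mod m i] & dio_bsem u A w) ->
  crt_sem (\prod_(i < n) m i) u g A X.
Proof.
move=> C mu.
have atom h a b : (forall i, i < n -> m i %| h \/ a = b %[mod m i]) ->
    h * a = h * b %[mod \prod_(i < n) m i].
  move=> H; apply: eqmod_prod => // i /H[/eqP D|E].
    by rewrite -modnMml D -[in RHS]modnMml D.
  by rewrite -modnMmr E modnMmr.
elim: A g X k => [i n'|i j|i j l|i j l|A IHA B IHB|A IHA B IHB|A IHA] g X k /=;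
  rewrite ?geq_max.
- move=> ik H; apply: atom => q /H[|[w Xw <-]]; [by left|right].
  exact: Xw.
- move=> /andP[ik jk] H; apply: atom => q /H[|[w Xw E]]; [by left|right].
  by rewrite !Xw // E.
- move=> /and3P[ik jk lk] H; apply: atom => q /H[|[w Xw E]]; [by left|right].
  by rewrite Xw // E -[LHS]modnDm -[RHS]modnDm !Xw.
- move=> /and3P[ik jk lk] H; apply: atom => q /H[|[w Xw E]]; [by left|right].
  by rewrite Xw // E -[LHS]modnMm -[RHS]modnMm !Xw.
- move=> /andP[Ak Bk] H; split; [apply: IHA Ak _ => // q|apply: IHB Bk _ => // q];
  by move=> /H[|[w Xw [HA HB]]]; [left|right; exists w].
- move=> /andP[Ak Bk] H; set M := \prod_(i < n) m i.
  pose ok A' i := m i %| g \/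
    exists2 w, forall j, j < k -> X j = w j %[mod m i] & dio_bsem u A' w.
  have [i lt_in|e He] := @chinese_exists m n
      (fun i a => a = 1 /\ ok A i \/ a = 0 /\ ok B i) C.
    have [D|[w Xw [HA|HB]]] := H i lt_in.
    + by exists 1; left; split=> //; left.
    + by exists 1; left; split=> //; right; exists w.
    + by exists 0; right; split=> //; right; exists w.
  have M0 : 0 < M.
    by apply: prodn_gt0 => i; have [+ _] := mu i (ltn_ord i); apply: leq_ltn_trans.
  have dM i : i < n -> m i %| M by apply: dvd_prod.
  (* [1 + e * M.-1] stands for 1 - e modulo [M]. *)
  have E' : e + (1 + e * M.-1) = 1 + e * M by rewrite addnCA -mulnS prednK.
  exists e, (1 + e * M.-1); split; first by rewrite E' addnC modnMDl.
  split.
    apply: (IHA _ _ k) => // i lt_in.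
    have [a [[-> [D|Aw]]|[-> _]] E] := He i lt_in.
    + by left; rewrite dvdn_mulr.
    + by right.
    + by left; rewrite dvdn_mull // /dvdn E mod0n.
  apply: (IHB _ _ k) => // i lt_in.
  have [a [[-> _]|[-> [D|Bw]]] E] := He i lt_in.
  + left; rewrite dvdn_mull //.
    have: e + (1 + e * M.-1) = 1 %[mod m i].
      by rewrite E' addnC; have /dvdnP[q ->] := dM i lt_in; rewrite mulnA modnMDl.
    rewrite -modnDml E modnDml -[in RHS](addn0 1) => /eqP.
    by rewrite eqn_modDl mod0n.
  + by left; rewrite dvdn_mulr.
  + by right.
- move=> Ak H.
  have [i lt_in|x Hx] := @chinese_exists m n (fun i a => a <= u /\ (m i %| g \/
     exists2 w, forall j, j < k -> X j = w j %[mod m i] &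
       dio_bsem u A (val_cons a w))) C.
    have [D|[w Xw [a au Aw]]] := H i lt_in; first by exists 0; split=> //; left.
    by exists a; split=> //; right; exists w.
  exists x; split.
    apply: prod_dvd => // i lt_in; have [um cop] := mu i lt_in.
    have [a [au _] E] := Hx i lt_in.
    (* Coprimality to (u + 1)! passes from the binomial to the falling factorial, which has the
       factor x - a; a is a remainder of x, so this difference is not truncated. *)
    rewrite -(Gauss_dvdl _ cop) bin_ffact ffact_prod.
    rewrite (bigD1 (Ordinal (au : a < u.+1))) //= dvdn_mulr //.
    rewrite -eqn_mod_dvd; first by rewrite E.
    have am : a < m i by apply: leq_ltn_trans um.
    by rewrite -(modn_small am) -E leq_mod.
  apply: (IHA _ _ k.+1) => // [|i lt_in]; first by case: (dio_fv A) Ak.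
  have [a [au [D|[w Xw Aw]]] E] := Hx i lt_in; first by left.
  by right; exists (val_cons a w) => // -[|j] //= jk; apply: Xw.
Qed.

(** * Bounded universal quantification *)

(* With [t] divisible by a large factorial, [binomial (t - 1) n] is the product of
   the moduli [t / (i + 1) - 1] for [i < n], modulo which [t] is [i + 1]. *)
Section FactorialModuli.
Variable u : nat.
Let N := u.+1 ^ 2.
Let f := N`!.
(** The square leaves a factor [f] in [crt_top %/ i.+1], so for i < u every prime factor of
    [crt_mod i] exceeds [N]. *)
Definition crt_top := f * f.
Definition crt_mod i := (crt_top %/ i.+1).-1.

Let le_uN : u.+1 <= N.
Proof. by rewrite /N -mulnn leq_pmull. Qed.

Let crt_modP i : i < u -> exists q,
  [/\ 0 < q, f = i.+1 * q, crt_top = i.+1 * (q * f) & (crt_mod i).+1 = q * f].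
Proof.
move=> iu; have f0 : 0 < f by apply: fact_gt0.
have /dvdnP[q fE] : i.+1 %| f.
  by rewrite dvdn_fact //= (leq_trans _ le_uN) // ltnW.
have q0 : 0 < q by rewrite lt0n; apply: contraTneq f0 => q0; rewrite fE q0.
have TE : crt_top = i.+1 * (q * f) by rewrite /crt_top {1}fE; lia.
exists q; split=> //; first by rewrite mulnC.
by rewrite /crt_mod TE mulKn // prednK // muln_gt0 q0.
Qed.

Lemma crt_top_mod i : i < u -> crt_top = i.+1 %[mod crt_mod i].
Proof.
move=> /crt_modP[q [_ _ -> <-]].
by rewrite mulnS addnC modnMDl.
Qed.

Lemma dvdn_fact_crt_mod d i : i < u -> 0 < d <= N -> d %| (crt_mod i).+1.
Proof. by move=> /crt_modP[q [_ _ _ ->]] dN; rewrite dvdn_mull // dvdn_fact. Qed.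

Lemma prime_dvd_crt_mod i p : i < u -> prime p -> p %| crt_mod i -> N < p.
Proof.
move=> iu pp pm; rewrite ltnNge; apply/negP => pN.
have := @dvdn_fact_crt_mod p i iu; rewrite prime_gt0 // pN => /(_ isT).
by rewrite -addn1 dvdn_addr // Euclid_dvd1.
Qed.

Lemma crt_mod_gt i : i < u -> u < crt_mod i.
Proof.
move=> iu; have [q [q0 _ _ E]] := crt_modP iu.
suff : u.+1 < q * f by rewrite -E.
apply: leq_trans (leq_pmull _ q0).
have N4 : u.+1 * 2 <= N by rewrite /N -mulnn leq_mul //; lia.
apply: leq_trans (_ : N <= f); first lia.
by rewrite dvdn_leq ?fact_gt0 // dvdn_fact // leqnn andbT; lia.
Qed.

Lemma crt_mod_coprime_fact i : i < u -> coprime (crt_mod i) u.+1`!.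
Proof.
move=> iu; have D : u.+1`! %| (crt_mod i).+1.
  have [q [_ _ _ ->]] := crt_modP iu.
  by rewrite dvdn_mull // /f (fact_split le_uN) dvdn_mulr.
exact: coprime_dvdr D (coprimenS _).
Qed.

(** Modulo a common prime, i + 1 and j + 1 would both equal [crt_top], yet both are below that
    prime. *)
Lemma crt_mod_pairwise n : n <= u -> pairwise_coprime crt_mod n.
Proof.
move=> nu i j /andP[ij jn].
have iu : i < u by lia.
have ju : j < u by lia.
rewrite /coprime; set d := gcdn _ _.
have d0 : 0 < d by rewrite gcdn_gt0 (leq_ltn_trans _ (crt_mod_gt iu)).
apply/eqP; case: (ltngtP d 1) => [|d1|//]; first by rewrite ltnNge d0.
have [p pp pd] : exists2 p, prime p & p %| d.
  by exists (pdiv d); [apply: pdiv_prime | apply: pdiv_dvd].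
have pi : p %| crt_mod i := dvdn_trans pd (dvdn_gcdl _ _).
have pj : p %| crt_mod j := dvdn_trans pd (dvdn_gcdr _ _).
have Np := prime_dvd_crt_mod iu pp pi.
have E : j.+1 = i.+1 %[mod p].
  exact: etrans (esym (eqmod_dvd pj (crt_top_mod ju))) (eqmod_dvd pi (crt_top_mod iu)).
have jp : j.+1 < p by apply: leq_ltn_trans ju (leq_ltn_trans (ltnW le_uN) Np).
have ip : i.+1 < p by apply: ltn_trans jp.
by move: E; rewrite !modn_small // => -[ji]; rewrite ji ltnn in ij.
Qed.

(** The factor [crt_top] - 1 - i of the falling factorial is (i + 1) times [crt_mod i], and the i +
    1 multiply to n!. *)
Lemma bin_crt_top n : n <= u ->
  'C(crt_top.-1, n) = \prod_(i < n) crt_mod i.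
Proof.
move=> nu; apply/eqP; rewrite -(eqn_pmul2r (fact_gt0 n)) bin_ffact; apply/eqP.
elim: n nu => [|n IHn] nu; first by rewrite big_ord0.
rewrite ffactnSr IHn; last exact: ltnW.
rewrite big_ord_recr factS [in RHS]/=.
have [q [q0 _ TE mE]] := crt_modP nu.
have -> : crt_top.-1 - n = n.+1 * crt_mod n by rewrite TE -mE mulnS; lia.
by rewrite [n.+1 * crt_mod n]mulnC mulnACA [n`! * _]mulnC.
Qed.

End FactorialModuli.

(** The variable starts at 1 because the single number [crt_top u] represents it at every modulus,
    with i + 1 as its residue at the i-th one. *)
Lemma ball_crt_sem A n v :
  (forall i, i < n -> dio_sem A (val_cons i.+1 v)) <->
  exists u, n <= u /\ dio_max_cst A <= u /\
    (forall j, j < dio_fv A -> v j <= u) /\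
    exists t, t.+1 = crt_top u /\
      crt_sem 'C(t, n) u 1 A (val_cons t.+1 v).
Proof.
split=> [H|[u [nu [Au [vu [t [tE SA]]]]]] i lt_in].
  have [N NP] : exists N, forall j, j < dio_fv A -> v j <= N.
    exists (\sum_(j < dio_fv A) v j) => j jA.
    by rewrite (bigD1 (Ordinal jA)) //= leq_addr.
  have [u] := @dio_sem_bsem_uniform A n (fun i => val_cons i.+1 v)
    (maxn N (maxn n (dio_max_cst A))) H.
  rewrite !geq_max => /and3P[Nu nu Au] Hu.
  exists u; split=> //; split=> //; split=> [j /NP|].
    by move/leq_trans; apply.
  have T0 : 0 < crt_top u by rewrite muln_gt0 fact_gt0.
  exists (crt_top u).-1; rewrite prednK //; split=> //.
  rewrite bin_crt_top //.
  apply: (@crt_sem_complete _ _ _ _ _ _ (dio_fv A)) => //.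
  - exact: crt_mod_pairwise.
  - move=> i lt_in; have iu := leq_trans lt_in nu.
    by split; [apply: crt_mod_gt | apply: crt_mod_coprime_fact].
  - move=> i lt_in; right; exists (val_cons i.+1 v); last exact: Hu.
    by case=> [|j] //= _; apply/crt_top_mod/(leq_trans lt_in).
have iu := leq_trans lt_in nu.
pose p := pdiv (crt_mod u i).
have pp : prime p.
  by apply: pdiv_prime; apply: leq_ltn_trans (crt_mod_gt iu); lia.
have pm : p %| crt_mod u i := pdiv_dvd _.
apply: (@crt_sem_sound p _ u 1 A _ _ (dio_fv A) pp _ _ _ _ Au _ SA) => //.
- have -> : t = (crt_top u).-1 by rewrite -tE.
  rewrite bin_crt_top //; apply: dvdn_trans pm _; exact: dvd_prod.
- exact: prime_dvd_crt_mod pm.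
- by rewrite Euclid_dvd1.
- case=> [|j] /= jA; last by split=> //; apply: vu; rewrite ltnW.
  split; first lia.
  by rewrite tE; apply: eqmod_dvd pm _; apply: crt_top_mod.
Qed.

(** As [k] is fixed outside the formula, a finite conjunction suffices. *)
Lemma dio_forall_lt_cst k (F : nat -> valuation -> nat) f :
  (forall j, dio_fun (F j)) -> dio_fun f ->
  dio_rel (fun v => forall j, j < k -> F j v <= f v).
Proof.
move=> DF Df; elim: k => [|k IHk].
  by apply: (dio_ext (S := fun v => 0 = 0)) => [v|]; [split | dio].
apply: (dio_ext (S := fun v => (forall j, j < k -> F j v <= f v) /\ F k v <= f v)).
  move=> v; split=> [[H Hk] j|H].
    by rewrite ltnS leq_eqVlt => /orP[/eqP->|/H].
  by split=> [j jk|]; apply: H => //; apply: ltnW.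
by apply: dio_conj => //; have DFk := DF k; dio.
Qed.

Lemma dio_ball (S : nat -> valuation -> Prop) f :
  dio_rel (fun v => S (v 0) (val_up v)) -> dio_fun f ->
  dio_rel (fun v => forall i, i < f v -> S i.+1 v).
Proof.
move=> [A AP] Df.
apply: (dio_ext (S := fun v => forall i, i < f v -> dio_sem A (val_cons i.+1 v))).
  by move=> v; split=> H i lt_if; apply/(AP (val_cons i.+1 v)); apply: H.
apply: (dio_ext (fun v => iff_sym (ball_crt_sem A (f v) v))).
have Df1 := dio_funup Df; have Df2 := dio_funup Df1.
apply: dio_ex; apply: dio_conj; first by apply: dio_le => //; apply: dio_var.
apply: dio_conj; first by dio.
apply: dio_conj.
  apply: (@dio_forall_lt_cst _ (fun j v => v j.+1)); last exact: dio_var.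
  by move=> j; apply: dio_var.
apply: dio_ex; apply: dio_conj; first by rewrite /crt_top; dio.
pose F i v : nat := if i is j.+1 then v j.+2 else (v 0).+1.
apply: (dio_ext (S := fun v =>
    crt_sem 'C(v 0, f (val_up (val_up v))) (v 1) 1 A (fun i => F i v))) => [v|].
  by apply: crt_sem_ext; case.
apply: (@dio_crt_sem A (fun v => 'C(v 0, f (val_up (val_up v)))) (fun v => v 1) (fun=> 1)).
- by apply: dio_bin => //; apply: dio_var.
- exact: dio_var.
- exact: dio_cst.
- by case=> [|i]; rewrite /F; dio.
Qed.

(** * Reflexive-transitive closure *)

Lemma digit_seq (s : nat -> nat) n :
  exists b c, forall i, i <= n -> digit b c i = s i.
Proof.
pose d i := if i <= n then s i else 0.
pose b := (\sum_(i < n.+1) s i).+1.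
have db i : d i < b.
  rewrite /d ltnS; case: (leqP i n) => // lt_in.
  by rewrite (bigD1 (Ordinal (lt_in : i < n.+1))) //= leq_addr.
exists b, (\sum_(i < n.+1) d i * b ^ i) => i lt_in.
by rewrite digit_sum // ltnS lt_in /d lt_in.
Qed.

Lemma clos_rt_path (R : nat -> nat -> Prop) x y : clos_refl_trans nat R x y ->
  exists n s, [/\ s 0 = x, s n = y & forall i, i < n -> R (s i) (s i.+1)].
Proof.
move=> xy; elim: (clos_rt_rtn1 _ _ _ _ xy) => {y xy} [|y z Ryz _ [n [s [s0 sn Hs]]]].
  by exists 0, (fun=> x).
exists n.+1, (fun i => if i <= n then s i else z); split=> // [|i]; first by rewrite ltnn.
rewrite ltnS => lt_in; rewrite lt_in; case: ltnP => [|ni]; first exact: Hs.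
by have -> : i = n by [apply/eqP; rewrite eqn_leq lt_in]; rewrite sn.
Qed.

Lemma path_clos_rt (R : nat -> nat -> Prop) (s : nat -> nat) n :
  (forall i, i < n -> R (s i) (s i.+1)) -> clos_refl_trans nat R (s 0) (s n).
Proof.
elim: n => [|n IHn] H; first exact: rt_refl.
apply: rt_trans (rt_step _ _ _ _ (H n (ltnSn n))); apply: IHn => i lt_in.
by apply: H; rewrite ltnW.
Qed.

(** The matrix of [dio_ball] sees only i + 1, so [j] recovers i through the equation. *)
Lemma clos_rt_digit (R : nat -> nat -> Prop) x y : clos_refl_trans nat R x y <->
  exists n b c, digit b c 0 = x /\ digit b c n = y /\
    forall i, i < n -> exists j, i.+1 = j.+1 /\ R (digit b c j) (digit b c i.+1).
Proof.
split=> [/clos_rt_path[n [s [s0 sn H]]]|[n [b [c [<- [<- H]]]]]].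
  have [b [c E]] := digit_seq s n.
  exists n, b, c; rewrite !E //; split=> //; split=> // i lt_in.
  by exists i; rewrite !E // ?(ltnW lt_in) //; split=> //; apply: H.
by apply: path_clos_rt => i /H[j [[<-]]].
Qed.

Theorem theorem2p10 (R : nat -> nat -> Prop) (f g : valuation -> nat) :
  dio_fun f ->
  dio_fun g ->
  dio_rel (fun v => R (v 1) (v 0)) ->
  dio_rel (fun v => clos_refl_trans nat R (f v) (g v)).
Proof.
move=> Df Dg DR.
apply: (dio_ext (fun v => iff_sym (clos_rt_digit R (f v) (g v)))).
have Df3 := dio_funup (dio_funup (dio_funup Df)).
have Dg3 := dio_funup (dio_funup (dio_funup Dg)).
(* [dio_subst2] expects the arguments in this order. *)
have DR' : dio_rel (fun v => R (v 0) (v 1)).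
  exact: (dio_ren (fun i => if i is 0 then 1 else 0) DR).
do 3!apply: dio_ex; rewrite /digit.
(* From here [v 0] is the code c, [v 1] the base b and [v 2] the path length n. *)
apply: dio_conj; first by apply: dio_eq; first dio.
apply: dio_conj; first by apply: dio_eq; first dio.
apply: (@dio_ball (fun i v => exists j, i = j.+1 /\
  R ((v 0 %/ v 1 ^ j) %% v 1) ((v 0 %/ v 1 ^ i) %% v 1))); last exact: dio_var.
apply: dio_ex; apply: dio_conj; first by dio.
by apply: (dio_subst2 DR'); dio.
Qed.
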